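(* The group $\tilde G=\langle a,\tilde b,\tilde c,\tilde d\rangle$ has intermediate growth.
   Context: Let $\mathcal T_2=\{0,1\}^*$ be the binary rooted tree; automorphisms act on the left on finite words. For a letter $x$ let $\overline x=x+1\bmod 2$. The automorphism $a$ is given by $a(x\sigma)=\overline x\sigma$. The automorphisms $\tilde b,\tilde c,\tilde d$ are defined recursively (all fixing both vertices of the first level) by $\tilde b(0x\sigma)=0\overline x\sigma$, $\tilde b(1\sigma)=1\tilde c(\sigma)$; $\tilde c(0\sigma)=0\sigma$, $\tilde c(1\sigma)=1\tilde d(\sigma)$; $\tilde d(0\sigma)=0\sigma$, $\tilde d(1\sigma)=1\tilde b(\sigma)$. $\tilde G$ is the subgroup of $\operatorname{Aut}(\mathcal T_2)$ generated by $a,\tilde b,\tilde c,\tilde d$. For a group $G$ generated by a finite set $S$, its growth function is $\gamma(n)=|\{g\in G: |g|\le n\}|$, where $|g|$ is the minimal length of $g$ as a word over $S$. Write $f\preceq g$ if there is a constant $C\in\mathbb N$ with $f(n)<Cg(Cn+C)+C$ for all $n\in\mathbb N$. $G$ has polynomial growth if $\gamma(n)\preceq n^k$ for some $k$, exponential growth if $e^n\preceq\gamma(n)$, and intermediate growth in the remaining cases (this does not depend on $S$). *)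

(* Defs.v *)
From HB Require Import structures.
From mathcomp Require Import all_boot all_order all_algebra all_fingroup finmap.
From mathcomp Require Import boolp classical_sets functions cardinality.
From mathcomp Require Import reals sequences exp.

Set Implicit Arguments.
Unset Strict Implicit.
Unset Printing Implicit Defensive.

Local Open Scope classical_set_scope.

(* Vertices are finite words over {0,1}, with 0 = false and 1 = true; the root
   is [::] and the children of v are rcons v false and rcons v true. *)
Definition vertex := seq bool.

Definition child (u v : vertex) : bool := (size v == (size u).+1) && prefix u v.

Definition adj (u v : vertex) : bool := child u v || child v u.

Record aut := Aut {
  aut_fun :> vertex -> vertex;
  aut_inv : vertex -> vertex;
  aut_funK : cancel aut_fun aut_inv;
  aut_invK : cancel aut_inv aut_fun;
  aut_root : aut_fun [::] = [::];
  aut_adj : {mono aut_fun : u v / adj u v}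
}.

Lemma aut_ext (g h : aut) : (forall v, g v = h v) -> g = h.
Proof.
case: g h => [f f' fK f'K f0 fm] [k k' kK k'K k0 km] /= /funext efk.
subst k.
have /funext e : forall v, f' v = k' v by move=> v; rewrite -{1}(k'K v) fK.
by subst k'; congr Aut; exact: Prop_irrelevance.
Qed.

Definition aut1 : aut :=
  @Aut id id (fun=> erefl) (fun=> erefl) erefl (fun _ _ => erefl).

Lemma aut_mul_adj (g h : aut) : {mono g \o h : u v / adj u v}.
Proof. by move=> u v /=; rewrite !aut_adj. Qed.

Lemma aut_mul_root (g h : aut) : (g \o h) [::] = [::].
Proof. by rewrite /= !aut_root. Qed.

(* Automorphisms act on the left: (g * h) v = g (h v). *)
Definition aut_mul (g h : aut) : aut :=
  Aut (can_comp (@aut_funK g) (@aut_funK h))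
      (can_comp (@aut_invK h) (@aut_invK g))
      (aut_mul_root g h) (@aut_mul_adj g h).

Lemma aut_inv_root (g : aut) : aut_inv g [::] = [::].
Proof. by rewrite -{1}(aut_root g) aut_funK. Qed.

Lemma aut_inv_adj (g : aut) : {mono aut_inv g : u v / adj u v}.
Proof. by move=> u v; rewrite -(aut_adj g) !aut_invK. Qed.

Definition aut_opp (g : aut) : aut :=
  Aut (@aut_invK g) (@aut_funK g) (aut_inv_root g) (@aut_inv_adj g).

Lemma aut_mulA : associative aut_mul.
Proof. by move=> x y z; exact: aut_ext. Qed.

Lemma aut_mul1g : left_id aut1 aut_mul.
Proof. by move=> x; exact: aut_ext. Qed.

Lemma aut_mulg1 : right_id aut1 aut_mul.
Proof. by move=> x; exact: aut_ext. Qed.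

Lemma aut_mulVg : left_inverse aut1 aut_opp aut_mul.
Proof. by move=> x; apply: aut_ext => v /=; rewrite aut_funK. Qed.

Lemma aut_mulgV : right_inverse aut1 aut_opp aut_mul.
Proof. by move=> x; apply: aut_ext => v /=; rewrite aut_invK. Qed.

HB.instance Definition _ := gen_eqMixin aut.
HB.instance Definition _ := gen_choiceMixin aut.
HB.instance Definition _ := isGroup.Build aut
  aut_mulA aut_mul1g aut_mulg1 aut_mulVg aut_mulgV.

Definition fun_a (w : vertex) : vertex :=
  if w is x :: s then ~~ x :: s else w.

Fixpoint fun_b (w : vertex) : vertex :=
  match w with
  | false :: x :: s => false :: ~~ x :: s
  | true :: s => true :: fun_c s
  | _ => w
  end
with fun_c (w : vertex) : vertex :=
  match w with
  | true :: s => true :: fun_d s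
  | _ => w
  end
with fun_d (w : vertex) : vertex :=
  match w with
  | true :: s => true :: fun_b s
  | _ => w
  end.

Lemma child_cons x y u v : child (x :: u) (y :: v) = (x == y) && child u v.
Proof. by rewrite /child /= eqSS; case: (x == y); rewrite // andbF. Qed.

Lemma adj_cons x y u v : adj (x :: u) (y :: v) = (x == y) && adj u v.
Proof. by rewrite /adj !child_cons eq_sym; case: (_ == _). Qed.

Lemma adj_nil (u v : vertex) : size u = 0%N -> adj u v = (size v == 1%N).
Proof.
by case: u => // _; rewrite /adj /child prefix0s andbT /= orbF.
Qed.

Lemma adjC u v : adj u v = adj v u.
Proof. by rewrite /adj orbC. Qed.

Lemma eq_adj_nil (f : vertex -> vertex) : (forall w, size (f w) = size w) ->
  (forall x y u v, adj (f (x :: u)) (f (y :: v)) = adj (x :: u) (y :: v)) ->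
  {mono f : u v / adj u v}.
Proof.
move=> fs fE [|x u] v; first by rewrite !adj_nil ?fs.
case: v => [|y v]; last exact: fE.
by rewrite adjC [RHS]adjC !adj_nil ?fs.
Qed.

Lemma fun_aK : involutive fun_a.
Proof. by case=> //= x s; rewrite negbK. Qed.

Lemma fun_a_adj : {mono fun_a : u v / adj u v}.
Proof.
apply: eq_adj_nil => [[]//|x y u v].
by rewrite /= !adj_cons; case: x; case: y.
Qed.

Lemma fun_bcdK s :
  [/\ fun_b (fun_b s) = s, fun_c (fun_c s) = s & fun_d (fun_d s) = s].
Proof.
elim: s => [//|[] s [hb hc hd]] /=; first by rewrite hb hc hd.
by case: s {hb hc hd} => //= x s; rewrite negbK.
Qed.

Lemma size_fun_bcd s :
  [/\ size (fun_b s) = size s, size (fun_c s) = size s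
    & size (fun_d s) = size s].
Proof.
elim: s => [//|[] s [hb hc hd]] /=; first by rewrite hb hc hd.
by case: s {hb hc hd}.
Qed.

Lemma fun_bcd_adj u v :
  [/\ adj (fun_b u) (fun_b v) = adj u v, adj (fun_c u) (fun_c v) = adj u v
    & adj (fun_d u) (fun_d v) = adj u v].
Proof.
have fb0 s : fun_b (false :: s) = false :: fun_a s by case: s.
elim: u v => [|x u IH] v.
  have [hb hc hd] := size_fun_bcd v.
  by rewrite !adj_nil ?hb ?hc ?hd.
case: v => [|y v].
  have [hb hc hd] := size_fun_bcd (x :: u).
  by rewrite !(adjC _ [::]) !adj_nil ?hb ?hc ?hd.
have [hb hc hd] := IH v.
case: x; case: y; rewrite ?fb0 /= !adj_cons //=.
by rewrite fun_a_adj.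
Qed.

Lemma fun_bK : involutive fun_b. Proof. by move=> s; case: (fun_bcdK s). Qed.
Lemma fun_cK : involutive fun_c. Proof. by move=> s; case: (fun_bcdK s). Qed.
Lemma fun_dK : involutive fun_d. Proof. by move=> s; case: (fun_bcdK s). Qed.

Lemma fun_b_adj : {mono fun_b : u v / adj u v}.
Proof. by move=> u v; case: (fun_bcd_adj u v). Qed.
Lemma fun_c_adj : {mono fun_c : u v / adj u v}.
Proof. by move=> u v; case: (fun_bcd_adj u v). Qed.
Lemma fun_d_adj : {mono fun_d : u v / adj u v}.
Proof. by move=> u v; case: (fun_bcd_adj u v). Qed.

Definition gen_a : aut := Aut fun_aK fun_aK erefl fun_a_adj.
Definition gen_b : aut := Aut fun_bK fun_bK erefl fun_b_adj.
Definition gen_c : aut := Aut fun_cK fun_cK erefl fun_c_adj.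
Definition gen_d : aut := Aut fun_dK fun_dK erefl fun_d_adj.

Section Growth.
Local Open Scope group_scope.
Context (gT : groupType).
Implicit Types (S H : set gT) (g : gT).

Definition is_subgroup H : Prop :=
  [/\ H 1, forall x y, H x -> H y -> H (x * y) & forall x, H x -> H x^-1].

Definition subgroup_generated S : set gT := smallest is_subgroup S.

(* The letters of a word over S are elements of S and their inverses. *)
Definition has_word S g (m : nat) : Prop :=
  exists w : seq gT, [/\ forall x, x \in w -> S x \/ S x^-1,
    \prod_(x <- w) x = g & size w = m].

(* Meaningful only for g in the subgroup generated by S: it is 0 otherwise. *)
Definition word_length S g : nat :=
  xget 0%N [set m | has_word S g m /\ forall k, has_word S g k -> (m <= k)%N].

Definition ball H S (n : nat) : set gT :=
  [set g | H g /\ (word_length S g <= n)%N].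

(* H is meant to be the subgroup generated by the finite set S; the ball is
   then finite (lemma finite_ball), so that fset_set has its elements. *)
Definition growth H S (n : nat) : nat := #|` fset_set (ball H S n)|.

Lemma has_word_generated S g : subgroup_generated S g -> exists m, has_word S g m.
Proof.
move=> Sg; apply: (Sg [set h | exists m, has_word S h m]); split=> [|x Sx]; last first.
  exists 1%N, [:: x]; split=> //; last by rewrite big_seq1.
  by move=> y; rewrite inE => /eqP ->; left.
split; first by exists 0%N, [::]; split=> //; rewrite big_nil.
- move=> _ _ [_ [w [wS <- _]]] [_ [v [vS <- _]]]; exists (size (w ++ v)), (w ++ v).
  by split=> // [x|]; [rewrite mem_cat => /orP[/wS|/vS]|rewrite big_cat].
- move=> _ [_ [w [wS <- _]]].
  exists (size (rev (map (fun x : gT => x^-1) w))), (rev (map (fun x : gT => x^-1) w)); split=> // [x|].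
    rewrite mem_rev => /mapP[y /wS yS ->].
    by rewrite invgK; case: yS; [right|left].
  elim: w {wS} => [|x w IH]; first by rewrite !big_nil invg1.
  by rewrite /= rev_cons -cats1 big_cat big_seq1 IH big_cons invgM.
Qed.

Lemma word_lengthP S g : subgroup_generated S g ->
  has_word S g (word_length S g) /\
  forall k, has_word S g k -> (word_length S g <= k)%N.
Proof.
move=> /has_word_generated[m hm]; rewrite /word_length.
have exP : exists n, `[< has_word S g n >] by exists m; apply/asboolP.
apply: (@xgetPex _ 0%N [set m | has_word S g m /\ _]).
case: (ex_minnP exP) => n /asboolP hn nmin.
by exists n; split=> // k hk; apply: nmin; apply/asboolP.
Qed.

Lemma finite_ball S n :
  finite_set S -> finite_set (ball (subgroup_generated S) S n).
Proof.
move=> finS; pose L : set gT := S `|` (fun x => x^-1) @` S.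
have finL : finite_set L by rewrite finite_setU; split=> //; exact: finite_image.
have finW m : finite_set [set g | has_word S g m].
  elim: m => [|m IH].
    apply: (sub_finite_set (B := [set 1])) => // g [w [_ <- /size0nil ->]].
    by rewrite big_nil.
  apply: (sub_finite_set (B := (fun p => p.1 * p.2) @`
            (L `*` [set g | has_word S g m]))).
    move=> g [[|x w] [wS <- //= [sw]]]; exists (x, \prod_(y <- w) y) => /=; last first.
      by rewrite big_cons.
    split=> /=.
      case: (wS x (mem_head x w)) => [Sx|Sx]; [by left|right].
      by exists x^-1; rewrite ?invgK.
    by exists w; split=> // y yw; apply: wS; rewrite inE yw orbT.
  by apply: finite_image; exact: finite_setX.
apply: (sub_finite_set (B := \bigcup_(m in `I_n.+1) [set g | has_word S g m])).
  move=> g [Hg lg]; exists (word_length S g) => //.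
  by case: (word_lengthP Hg).
by apply: bigcup_finite => // m _; exact: finW.
Qed.

End Growth.

Section GrowthType.
Import GRing.Theory Num.Theory.
Local Open Scope ring_scope.
Context (R : realType).

Definition growth_le (f g : nat -> R) : Prop :=
  exists C : nat, forall n : nat, f n < C%:R * g (C * n + C)%N + C%:R.

Context (gT : groupType) (H S : set gT).

Definition polynomial_growth : Prop :=
  exists k : nat, growth_le (fun n => (growth H S n)%:R) (fun n => n%:R ^+ k).

Definition exponential_growth : Prop :=
  growth_le (fun n => expR n%:R) (fun n => (growth H S n)%:R).

Definition intermediate_growth : Prop :=
  ~ polynomial_growth /\ ~ exponential_growth.

End GrowthType.

Definition Gtilde_gens : set aut := [set gen_a; gen_b; gen_c; gen_d].

Definition Gtilde : set aut := subgroup_generated Gtilde_gens.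

(* Main.v *)
From mathcomp Require Import all_boot all_order all_algebra finmap zify ring lra.
From mathcomp Require Import boolp classical_sets cardinality.
From mathcomp Require Import reals sequences exp.
Require Import Defs.

Set Implicit Arguments.
Unset Strict Implicit.
Unset Printing Implicit Defensive.

(** The elements b, c, d commute and generate a group of order 8, so every
element of the group is represented by a word in the letters a and x, where x
is a product b^i c^j d^k.  Such an x acts on the subtree below 0 as a^i, and on
the subtree below 1 as shift x, the image of x under the cyclic substitution
b -> c -> d -> b.  Both halves of the theorem compare an element with its two
sections, which is what self-similarity offers.

The growth is subexponential.  Give the letters the weights a = 3, b = 4,
c = 2, d = 3, bc = 4, cd = 3, bd = 5, bcd = 4.  In a word where letters x
alternate with a, a pair (x, a) contributes the letter shift x to one section
and a^i to the other, and the weights are such that this loses at least 1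
unless x = t := bcd.  Hence the minimal weights satisfy
|g0| + |g1| <= |g| - N(g) + 12, where N(g) is the number of letters other than
t in a minimal alternating word of g ([len_section_at]).  The letter t loses
nothing, but alternating words in which almost all letters are t are few.  To
combine the two facts, let xi be the infimum of the x > 0 such that the sum of
exp(-x|g|) over the group is finite, and suppose xi > 0.  Since g is determined
by its sections and its action on the first level, finiteness at x bounds the
sum of exp(-x(|g| - N(g))) ([sum_section_at]).  Moreover, for zeta large, the
sum of exp(-xi|g|/4 - zeta N(g)) is bounded by a geometric series over
alternating words ([sum_slack]).  If eps > 0 is small, exp(-x(1-eps)|g|) is at
most the first summand when N(g) >= eps|g| and at most the second one
otherwise.  So the sum is finite at x(1-eps), which lies below xi for x close
to xi.  This contradiction gives finiteness for all x > 0 ([summable_pos]).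

The growth is superpolynomial.  The substitution a -> aba, b -> d, c -> b,
d -> c sends a word w to a word whose section at 1 is w, while its section at 0
lies in the dihedral group of order 8 generated by a and c.  Conjugating by a
exchanges the two sections, so a pair of elements of the ball of radius n is
recovered from one element of the ball of radius 6n+2 together with two
elements of that dihedral group: gamma(n)^2 <= 64 gamma(6n+2)
([size_evals_sqr]).  As at has infinite order, gamma(2n) > n, and iterating the
square k times excludes polynomial growth of degree k. *)

(** * Words in a and the products of b, c, d *)

(** The triple (i, j, k) stands for b^i c^j d^k. *)
Definition bcd := (bool * bool * bool)%type.
Definition bcd1 : bcd := (false, false, false).
Definition bcd_t : bcd := (true, true, true).
Definition bcd_mul (x y : bcd) : bcd :=
  (x.1.1 (+) y.1.1, x.1.2 (+) y.1.2, x.2 (+) y.2).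
Definition has_b (x : bcd) : bool := x.1.1.
Definition shift (x : bcd) : bcd := (x.2, x.1.1, x.1.2).

Definition bcd_aut (x : bcd) : aut :=
  (gen_b ^+ x.1.1 * gen_c ^+ x.1.2 * gen_d ^+ x.2)%g.

Lemma autM (g h : aut) v : (g * h)%g v = g (h v).
Proof. by []. Qed.

Lemma fun_b_false s : fun_b (false :: s) = false :: fun_a s.
Proof. by case: s. Qed.

Lemma fun_bcd_comm s :
  [/\ fun_b (fun_c s) = fun_c (fun_b s), fun_c (fun_d s) = fun_d (fun_c s)
    & fun_b (fun_d s) = fun_d (fun_b s)].
Proof.
elim: s => [//|[] s [bc cd bd]]; first by rewrite /= bc cd bd.
by case: s {bc cd bd}.
Qed.

(** This is the recursion that defines b, c, d, for all their products at once. *)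
Lemma bcd_aut_cons x p s : bcd_aut x (p :: s) =
  p :: (if p then bcd_aut (shift x) s else if has_b x then gen_a s else s).
Proof.
case: p; last by case: x => [[[] []] []] //=; case: s.
have bc u : fun_b (fun_c u) = fun_c (fun_b u) by case: (fun_bcd_comm u).
have bd u : fun_b (fun_d u) = fun_d (fun_b u) by case: (fun_bcd_comm u).
by case: x => [[[] []] []]; rewrite /= -?bd -?bc.
Qed.

Lemma bcd_aut_nil x : bcd_aut x [::] = [::].
Proof. exact: aut_root. Qed.

Lemma bcd_autM x y : bcd_aut (bcd_mul x y) = (bcd_aut x * bcd_aut y)%g.
Proof.
apply: aut_ext => s; rewrite autM.
elim: s x y => [|p s IH] x y; first by rewrite !bcd_aut_nil.
rewrite !bcd_aut_cons; congr (_ :: _); case: p; first by rewrite -IH.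
by case: x y => [[[] ?] ?] [[[] ?] ?] //=; rewrite fun_aK.
Qed.

Lemma bcd_aut1 : bcd_aut bcd1 = 1%g.
Proof. exact: aut_ext. Qed.

Lemma gen_aK : (gen_a * gen_a = 1)%g.
Proof. by apply: aut_ext => v /=; rewrite fun_aK. Qed.

(** [None] is the letter a. *)
Definition letter := option bcd.
Definition letter_aut (l : letter) : aut := if l is Some x then bcd_aut x else gen_a.
Definition eval (w : seq letter) : aut := (\prod_(l <- w) letter_aut l)%g.

Lemma eval_nil : eval [::] = 1%g.
Proof. exact: big_nil. Qed.
Lemma eval_cons l w : eval (l :: w) = (letter_aut l * eval w)%g.
Proof. exact: big_cons. Qed.
Lemma eval_cat u v : eval (u ++ v) = (eval u * eval v)%g.
Proof. exact: big_cat. Qed.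

(** * Sections *)

(** Whether the word exchanges the two vertices of the first level. *)
Definition flips (w : seq letter) : bool := odd (count_mem None w).

(** Letters act from right to left, so the vertex that the head letter meets is
[p] moved by the tail of the word. *)
Fixpoint section (p : bool) (w : seq letter) : seq letter :=
  if w isn't l :: w' then [::] else
  if l isn't Some x then section p w' else
  if p (+) flips w' then Some (shift x) :: section p w' else
  if has_b x then None :: section p w' else section p w'.

Lemma flips_cons l w : flips (l :: w) = (l == None) (+) flips w.
Proof. by rewrite /flips /= oddD; case: l. Qed.

Lemma eval_section w p s :
  eval w (p :: s) = (p (+) flips w) :: eval (section p w) s.
Proof.
elim: w => [|l w IH]; first by rewrite !eval_nil addbF.
rewrite eval_cons autM IH flips_cons; case: l => [x|]; last by rewrite addbN.
rewrite [letter_aut _]/= bcd_aut_cons; congr (_ :: _) => /=.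
by case: (p (+) flips w); case: (has_b x); rewrite ?eval_cons.
Qed.

Lemma eval_section_inj u v : flips u = flips v ->
  (forall p, eval (section p u) = eval (section p v)) -> eval u = eval v.
Proof.
move=> f e; apply: aut_ext => -[|p s]; first by rewrite !aut_root.
by rewrite !eval_section f e.
Qed.

(** * Weights and alternating words *)

(** Let a have weight 3.  A letter x and the a that follows it are replaced by
shift x and a^i, which loses W(x) - W(shift x) + 3(1 - i).  Along an orbit of
[shift] these losses add up to 3 times the number of letters without b: to 6 on
{b, c, d} and to 3 on {bc, cd, bd}.  Asking for an equal loss along each orbit,
2 and 1 respectively, fixes the weights up to one constant per orbit; the
constants are large enough for [bcd_weightM].  On t the loss is 0 whatever its
weight. *)
Definition bcd_weight (x : bcd) : nat :=
  match x with
  | (false, false, false) => 0 | (true, false, false) => 4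
  | (false, true, false) => 2 | (false, false, true) => 3
  | (true, true, false) => 4 | (false, true, true) => 3
  | (true, false, true) => 5 | (true, true, true) => 4
  end.
Arguments bcd_weight : simpl never.
Definition letter_weight (l : letter) : nat := if l is Some x then bcd_weight x else 3.
Definition weight (w : seq letter) : nat := \sum_(l <- w) letter_weight l.

Lemma bcd_weightM x y : bcd_weight (bcd_mul x y) <= bcd_weight x + bcd_weight y.
Proof. by case: x y => [[[] []] []] [[[] []] []]. Qed.
Lemma bcd_weight_shift x :
  bcd_weight (shift x) + 3 * has_b x + (x != bcd_t) <= bcd_weight x + 3.
Proof. by case: x => [[[] []] []]. Qed.

(** Every element has a word of this form, because a letter x_i may be trivial. *)
Definition alt (w : seq bcd) : seq letter := flatten [seq [:: Some x; None] | x <- w].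
Definition aeval (w : seq bcd) : aut := eval (alt w).
Definition aweight (w : seq bcd) : nat := \sum_(x <- w) (bcd_weight x + 3).
(** The number of letters on which taking sections loses weight. *)
Definition slack (w : seq bcd) : nat := count (predC1 bcd_t) w.

Lemma aeval_nil : aeval [::] = 1%g.
Proof. exact: eval_nil. Qed.
Lemma aeval_cons x w : aeval (x :: w) = (bcd_aut x * gen_a * aeval w)%g.
Proof. by rewrite /aeval /= !eval_cons mulgA. Qed.

Lemma weight_cons l w : weight (l :: w) = letter_weight l + weight w.
Proof. exact: big_cons. Qed.
Lemma aweight_cons x w : aweight (x :: w) = bcd_weight x + 3 + aweight w.
Proof. exact: big_cons. Qed.

(** For each letter x of [w], one section receives shift x and the other a^i; which
one is which depends on the parity of the number of letters that follow. *)
Lemma weight_sections w :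
  weight (section false (alt w)) + weight (section true (alt w)) + slack w
    <= aweight w.
Proof.
elim: w => [|x w IH]; first by rewrite /weight /aweight !big_nil.
have := bcd_weight_shift x; rewrite aweight_cons /= flips_cons /=.
case: (flips _); case: (has_b x); rewrite /= -/(alt w) ?weight_cons /=; lia.
Qed.

(** Multiplication on the left by a letter, absorbed in an alternating word. *)
Definition push (l : letter) (w : seq bcd) : seq bcd :=
  match l, w with
  | None, _ => bcd1 :: w
  | Some x, y :: w' => bcd_mul x y :: w'
  | Some x, [::] => [:: x; bcd1]
  end.
Definition alternate (w : seq letter) : seq bcd := foldr push [:: bcd1; bcd1] w.

Lemma aeval_push l w : aeval (push l w) = (letter_aut l * aeval w)%g.
Proof.
case: l => [x|] /=; last by rewrite aeval_cons bcd_aut1 mul1g.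
case: w => [|y w].
  by rewrite !aeval_cons aeval_nil bcd_aut1 mul1g mulg1 -mulgA gen_aK mulg1.
by rewrite !aeval_cons bcd_autM !mulgA.
Qed.

Lemma aeval_alternate w : aeval (alternate w) = eval w.
Proof.
elim: w => [|l w IH]; last by rewrite /= aeval_push IH eval_cons.
by rewrite !aeval_cons aeval_nil eval_nil bcd_aut1 !mul1g mulg1 gen_aK.
Qed.

(** The excess 6 is the weight of 1a1a, which represents the empty word. *)
Lemma aweight_alternate w : aweight (alternate w) <= weight w + 6.
Proof.
have weight1 : bcd_weight bcd1 = 0 by [].
have aweight0 : aweight [::] = 0 by exact: big_nil.
elim: w => [|l w IH]; first by rewrite !aweight_cons aweight0 /weight big_nil.
rewrite weight_cons /=; case: l => [x|] /=; last by rewrite aweight_cons; lia.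
case: (alternate w) IH => [|y u]; first by rewrite !aweight_cons; lia.
by rewrite !aweight_cons; have := bcd_weightM x y; lia.
Qed.

(** * Balls *)

Fixpoint words (T : finType) (n : nat) : seq (seq T) :=
  if n is n'.+1 then [::] :: [seq l :: w | l <- enum T, w <- words T n']
  else [:: [::]].

Lemma mem_words (T : finType) n (w : seq T) : (w \in words T n) = (size w <= n).
Proof.
elim: n w => [|n IH] [|l w] //=; rewrite inE /=.
apply/allpairsP/idP => [[[l' w'] /= [_ w'n [_ ->]]]|wn]; first by rewrite ltnS -IH.
by exists (l, w); rewrite mem_enum IH.
Qed.

Definition evals (n : nat) : seq aut := undup (map eval (words letter n)).

Lemma evalsP n g : reflect (exists2 w, size w <= n & eval w = g) (g \in evals n).
Proof.
rewrite mem_undup; apply: (iffP mapP) => [[w ww ->]|[w wn <-]]; exists w => //.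
  by rewrite -mem_words.
by rewrite mem_words.
Qed.

(** * The substitution and its shadow *)

Definition unshift (x : bcd) : bcd := (x.1.2, x.2, x.1.1).
Lemma unshiftK : cancel unshift shift.
Proof. by case=> [[? ?] ?]. Qed.

(** The substitution a -> aba, x -> shift^-1 x, chosen so that the section at 1 of
the lift of a word is the word itself. *)
Definition lift_letter (l : letter) : seq letter :=
  if l is Some x then [:: Some (unshift x)]
  else [:: None; Some (true, false, false); None].
Definition lift (w : seq letter) : seq letter := flatten (map lift_letter w).
(** What the lift leaves behind at the vertex 0. *)
Definition shadow_letter (l : letter) : seq letter :=
  if l is Some x then if has_b (unshift x) then [:: None] else [::]
  else [:: Some (false, true, false)].
Definition shadow (w : seq letter) : seq letter := flatten (map shadow_letter w).

Lemma flips_cat u v : flips (u ++ v) = flips u (+) flips v.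
Proof. by rewrite /flips count_cat oddD. Qed.

Lemma section_cat p u v :
  section p (u ++ v) = section (p (+) flips v) u ++ section p v.
Proof.
elim: u => [//|[x|] u IH] /=; rewrite IH // flips_cat.
by rewrite addbA (addbAC p); case: (_ (+) _); case: (has_b x).
Qed.

Lemma flips_lift w : flips (lift w) = false.
Proof. by elim: w => [//|[x|] w IH]; rewrite /lift /= -/(lift w) !flips_cons IH. Qed.

Lemma section_lift w :
  section true (lift w) = w /\ section false (lift w) = shadow w.
Proof.
elim: w => [//|l w [IHt IHf]].
rewrite /lift /shadow /= -/(lift w) -/(shadow w) !section_cat IHt IHf flips_lift.
by case: l => [x|] //=; rewrite unshiftK.
Qed.

Lemma size_lift w : size (lift w) <= 3 * size w.
Proof.
elim: w => [//|l w IH]; rewrite /lift /= size_cat -/(lift w).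
by case: l => [x|] /=; lia.
Qed.

(** The elements of the dihedral group generated by a and c: as c and aca commute,
they are a^i c^j (aca)^k. *)
Definition shadow_val (e : bool * bool * bool) : aut :=
  let: (i, j, k) := e in
  (gen_a ^+ i * (gen_c ^+ j * (gen_a * gen_c * gen_a) ^+ k))%g.

Lemma gen_cK : (gen_c * gen_c = 1)%g.
Proof. by apply: aut_ext => v /=; rewrite fun_cK. Qed.

Lemma shadow_finite w : exists e, eval (shadow w) = shadow_val e.
Proof.
elim: w => [|l w [[[i j] k] IH]].
  by exists (false, false, false); rewrite eval_nil /= !mulg1.
rewrite /shadow /= -/(shadow w) eval_cat IH.
have a_mul : exists e, (gen_a * shadow_val (i, j, k))%g = shadow_val e.
  exists (~~ i, j, k); rewrite /= mulgA; congr (_ * _)%g.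
  by case: i {IH}; rewrite ?mulg1 ?gen_aK.
have c_mul : exists e, (gen_c * shadow_val (i, j, k))%g = shadow_val e.
  case: i {IH a_mul}.
    exists (true, j, ~~ k).
    by case: j; case: k; apply: aut_ext => -[|[] s] //=; rewrite ?fun_dK.
  exists (false, ~~ j, k); rewrite /= !mul1g mulgA; congr (_ * _)%g.
  by case: j; rewrite ?mulg1 ?gen_cK.
have bcd_c : bcd_aut (false, true, false) = gen_c by exact: aut_ext.
rewrite /shadow_letter; case: l => [x|]; last first.
  by rewrite eval_cons eval_nil mulg1 /letter_aut bcd_c.
case: (has_b _); last by exists (i, j, k); rewrite eval_nil mul1g.
by rewrite eval_cons eval_nil mulg1.
Qed.

(** Conjugation by a exchanges the two sections of the lift of [v]. *)
Definition pair_word (u v : seq letter) : seq letter :=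
  lift u ++ None :: lift v ++ [:: None].

Lemma section_pair u v :
  eval (section false (pair_word u v)) = (eval (shadow u) * eval v)%g /\
  eval (section true (pair_word u v)) = (eval u * eval (shadow v))%g.
Proof.
have [ut uf] := section_lift u; have [vt vf] := section_lift v.
have fl : flips (None :: lift v ++ [:: None]) = false.
  by rewrite flips_cons flips_cat flips_lift.
by rewrite /pair_word !section_cat fl /= !section_cat /= !cats0 !eval_cat ut uf vt vf.
Qed.

(** The word [pair_word u v] evaluates to (shadow u * v, u * shadow v), from which u
and v are recovered when the two shadows are known; each has 8 possible values. *)
Lemma size_evals_sqr n : size (evals n) ^ 2 <= 64 * size (evals (6 * n + 2)).
Proof.
pose word g : seq letter := xget [::] [set w | (size w <= n) /\ eval w = g].
have wordP g : g \in evals n -> size (word g) <= n /\ eval (word g) = g.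
  move=> /evalsP[w wn wg].
  by apply: (@xgetPex _ [::] [set w | (size w <= n) /\ eval w = g]); exists w.
pose sh g := sval (cid (shadow_finite (word g))).
have shE g : eval (shadow (word g)) = shadow_val (sh g)
  by exact: (svalP (cid (shadow_finite (word g)))).
pose f (p : aut * aut) :=
  (eval (pair_word (word p.1) (word p.2)), (sh p.1, sh p.2)).
have f_inj : {in [seq (g, h) | g <- evals n, h <- evals n] &, injective f}.
  move=> _ _ /allpairsP[[g h] /= [gn hn ->]] /allpairsP[[g' h'] /= [g'n h'n ->]].
  rewrite /f /= => -[e eg eh].
  have [_ wg] := wordP _ gn; have [_ wh] := wordP _ hn.
  have [_ wg'] := wordP _ g'n; have [_ wh'] := wordP _ h'n.
  have [s0 s1] := section_pair (word g) (word h).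
  have [s0' s1'] := section_pair (word g') (word h').
  (* The two words represent the same element, hence have the same sections. *)
  have es q s : eval (section q (pair_word (word g) (word h))) s
     = eval (section q (pair_word (word g') (word h'))) s.
    have /(congr1 behead) := eval_section (pair_word (word g) (word h)) q s.
    by rewrite e eval_section /= => ->.
  congr (_, _).
    have := aut_ext (es true); rewrite s1 s1' !shE eh wg wg'; exact: mulIg.
  have := aut_ext (es false); rewrite s0 s0' !shE eg wh wh'; exact: mulgI.
rewrite -[64]/(8 * 8) -!mulnA.
pose bools := enum {: bool * bool * bool}.
have bools_size : size bools = 8 by rewrite /bools -cardE !card_prod card_bool.
have -> : 8 * (8 * size (evals (6 * n + 2))) =
    size [seq (g, e) | g <- evals (6 * n + 2),
                       e <- [seq (e, e') | e <- bools, e' <- bools]].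
  by rewrite !size_allpairs bools_size mulnC mulnA mulnAC [RHS]mulnC mulnA; lia.
rewrite -mulnn -(size_allpairs pair) -(size_map f); apply: uniq_leq_size.
  rewrite map_inj_in_uniq //; apply: allpairs_uniq; rewrite ?undup_uniq //.
  by move=> [? ?] [? ?] _ _ [-> ->].
move=> _ /mapP[_ /allpairsP[[g h] /= [gn hn ->]] ->].
apply/allpairsP; eexists (_, _); split=> //=; last first.
  by apply/allpairsP; exists (sh g, sh h); rewrite /= !mem_enum.
apply/evalsP; eexists; last reflexivity.
have [sg _] := wordP _ gn; have [sh' _] := wordP _ hn.
rewrite size_cat /= size_cat /=.
by have := size_lift (word g); have := size_lift (word h); lia.
Qed.

Definition rho : aut := (gen_a * bcd_aut bcd_t)%g.

Lemma rhoE v : rho v = fun_a (bcd_aut bcd_t v).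
Proof. by []. Qed.

Lemma rho_double n s : (rho ^+ n.*2)%g (true :: s) = true :: (rho ^+ n)%g s.
Proof.
elim: n s => [//|n IH] s.
rewrite doubleS !expgS autM (autM rho) IH !rhoE bcd_aut_cons.
by rewrite [fun_a (true :: _)]/= bcd_aut_cons.
Qed.

Lemma rho_parity n p s : exists s', (rho ^+ n)%g (p :: s) = (p (+) odd n) :: s'.
Proof.
elim: n => [|n [s' IH]]; first by exists s; rewrite addbF.
rewrite expgS autM IH rhoE bcd_aut_cons /=; eexists.
by rewrite addbN.
Qed.

(** The section of [rho]^2 at 1 is [rho] again.  A trivial power of [rho] has an even
exponent, since it fixes the first level, and then the power of half that
exponent is trivial too; repeating this contradicts that the exponent is
positive. *)
Lemma rho_exp_neq1 n : 0 < n -> (rho ^+ n)%g <> 1%g.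
Proof.
elim/ltn_ind: n => n IH n_gt0 e.
have n_even : odd n = false.
  have [s] := rho_parity n true [::]; rewrite e /=.
  by case: (odd n).
have half_lt : n./2 < n by rewrite -[X in _ < X]odd_double_half n_even; lia.
apply: (IH _ half_lt); first by lia.
apply: aut_ext => s; have := rho_double n./2 s.
by rewrite even_halfK ?n_even // e => -[].
Qed.

Lemma rho_exp_inj : injective (fun n => rho ^+ n)%g.
Proof.
suff le m n : m <= n -> (rho ^+ m = rho ^+ n)%g -> m = n.
  move=> m n /= e; case: (leqP m n) => [|/ltnW] mn; first exact: le.
  by rewrite (le n m).
move=> mn e; apply/eqP; rewrite eqn_leq mn leqNgt -subn_gt0.
apply/negP => /rho_exp_neq1; apply.
apply: (mulgI (rho ^+ m)%g); rewrite -expgnDr subnKC //.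
by rewrite mulg1.
Qed.

Lemma ltn_size_evals n : n < size (evals (2 * n)).
Proof.
rewrite -[n.+1](size_iota 0) -(size_map (fun i => rho ^+ i)%g).
apply: uniq_leq_size => [|_ /mapP[i + ->]].
  by rewrite (map_inj_uniq rho_exp_inj) iota_uniq.
rewrite mem_iota => i_le; apply/evalsP.
exists (flatten (nseq i [:: None; Some bcd_t])).
  by rewrite size_flatten /shape map_nseq sumn_nseq /=; lia.
elim: i {i_le} => [|i IH]; first by rewrite eval_nil.
by rewrite expgS -IH /= !eval_cons /rho mulgA.
Qed.

Lemma evals_mono m n : m <= n -> {subset evals m <= evals n}.
Proof.
move=> mn g /evalsP[w wm <-].
by apply/evalsP; exists w => //; exact: leq_trans mn.
Qed.

Lemma leq_size_evals m n : m <= n -> size (evals m) <= size (evals n).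
Proof.
by move=> mn; apply: uniq_leq_size (undup_uniq _) (evals_mono mn).
Qed.

(** The factor 64 on the left makes the squaring step exact: (64 X)^2 = 64 (64 X^2). *)
Lemma size_evals_iter n j : 0 < n ->
  size (evals n) ^ 2 ^ j * 64 <= 64 ^ 2 ^ j * size (evals (8 ^ j * n)).
Proof.
move=> n_gt0; elim: j => [|j IH]; first by rewrite mul1n mulnC.
have step : size (evals (8 ^ j * n)) ^ 2 <= 64 * size (evals (8 ^ j.+1 * n)).
  apply: leq_trans (size_evals_sqr _) _; rewrite leq_mul2l /=.
  by apply: leq_size_evals; have := expn_gt0 8 j; rewrite expnS; nia.
rewrite expnSr !expnM.
move: IH step; set x := _ ^ 2 ^ j; set y := 64 ^ 2 ^ j => IH step.
rewrite -(@leq_pmul2r 64) // -[leqLHS]mulnA mulnn -expnMn.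
apply: (@leq_trans ((y * size (evals (8 ^ j * n))) ^ 2)); first by rewrite leq_sqr.
by rewrite expnMn -mulnA leq_mul2l [_ * 64]mulnC step orbT.
Qed.

(** * Comparison with the word metric of the four generators *)

Local Notation growthG := (growth Gtilde Gtilde_gens).

Lemma finite_gens : finite_set Gtilde_gens.
Proof. by rewrite /Gtilde_gens !finite_setU; do !split; exact: finite_set1. Qed.

Lemma gens_letter g : Gtilde_gens g -> exists l, letter_aut l = g.
Proof.
case=> [[[]|]|] ->; first by exists None.
- by exists (Some (true, false, false)); exact: aut_ext.
- by exists (Some (false, true, false)); exact: aut_ext.
- by exists (Some (false, false, true)); exact: aut_ext.
Qed.

Lemma letter_autV l : ((letter_aut l)^-1 = letter_aut l)%g.
Proof.
apply: mulg1_eq.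
case: l => [x|]; last exact: gen_aK.
by rewrite -bcd_autM -bcd_aut1 /bcd_mul !addbb.
Qed.

Lemma has_word_in_evals g m : has_word Gtilde_gens g m -> g \in evals m.
Proof.
case=> w [wS <- <-]; elim: w wS => [|x w IH] wS.
  by apply/evalsP; exists [::]; rewrite // eval_nil big_nil.
have /evalsP[u uw ew] : (\prod_(y <- w) y)%g \in evals (size w).
  by apply: IH => y yw; apply: wS; rewrite inE yw orbT.
have [l lx] : exists l, letter_aut l = x.
  case: (wS x (mem_head _ _)) => /gens_letter[l lx]; exists l => //.
  by rewrite -letter_autV lx invgK.
by apply/evalsP; exists (l :: u); rewrite // eval_cons big_cons lx ew.
Qed.

Lemma evals_ball n g : g \in evals n -> ball Gtilde Gtilde_gens (3 * n) g.
Proof.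
have [ga gb gc gd] : [/\ Gtilde_gens gen_a, Gtilde_gens gen_b,
   Gtilde_gens gen_c & Gtilde_gens gen_d].
  by split; [left; left; left|left; left; right|left; right|right].
move=> /evalsP[w wn <-].
suff [m mn [v [vS ve vm]]] : exists2 m, m <= 3 * size w &
    exists v, [/\ {in v, forall x, Gtilde_gens x}, (\prod_(x <- v) x)%g = eval w & size v = m].
  have Gw : Gtilde (eval w).
    rewrite -ve => H [[H1 HM HV] SH]; elim: v vS {ve vm} => [|x v IH] vS.
      by rewrite big_nil.
    rewrite big_cons; apply: HM; first by apply/SH/vS/mem_head.
    by apply: IH => y yv; apply: vS; rewrite inE yv orbT.
  split=> //; have [_] := word_lengthP Gw => /(_ m) le; apply: leq_trans (le _) _.
    by exists v; split=> // x /vS; left.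
  by lia.
elim: w {wn} => [|l w [m mw [v [vS ve vm]]]].
  by exists 0 => //; exists [::]; rewrite big_nil eval_nil.
have [u [uS ue us]] : exists u, [/\ {in u, forall x, Gtilde_gens x},
    (\prod_(x <- u) x)%g = letter_aut l & size u <= 3].
  case: l => [x|].
    exists (nseq x.1.1 gen_b ++ nseq x.1.2 gen_c ++ nseq x.2 gen_d); split.
    - by move=> y; rewrite !mem_cat => /or3P[] /nseqP[-> _].
    - by rewrite !big_cat /= mulgA; case: x => [[[] []] []]; rewrite /= ?big_seq1 ?big_nil.
    - by rewrite !size_cat !size_nseq; case: x => [[[] []] []].
  exists [:: gen_a]; rewrite big_seq1; split=> // x.
  by rewrite inE => /eqP ->.
exists (size (u ++ v)); first by rewrite size_cat vm mulnS leq_add.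
exists (u ++ v); split=> //; last by rewrite big_cat eval_cons ue ve.
by move=> x; rewrite mem_cat => /orP[/uS|/vS].
Qed.

Lemma growth_le_evals n : growthG n <= size (evals n).
Proof.
apply: uniq_leq_size; first exact: fset_uniq.
move=> g; rewrite in_fset_set; last exact/finite_ball/finite_gens.
rewrite inE => -[/word_lengthP[gw _] gn].
exact/(evals_mono gn)/has_word_in_evals.
Qed.

Lemma evals_le_growth n : size (evals n) <= growthG (3 * n).
Proof.
apply: uniq_leq_size; first exact: undup_uniq.
move=> g /evals_ball gn; rewrite in_fset_set ?inE //.
exact/finite_ball/finite_gens.
Qed.

(** * Superpolynomial growth *)

Section Lower.
Context (R : realType).
Import GRing.Theory Num.Theory.
Local Open Scope ring_scope.

(** If gamma(n) is at most of the order of n^k, then (n+1)^(2^k), which is at most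
gamma(2n)^(2^k), is at most a constant times gamma(3 * 8^k * 2n), hence of order
n^k in n; but k < 2^k. *)
Lemma not_polynomial : ~ polynomial_growth R Gtilde Gtilde_gens.
Proof.
move=> [k [C growC]].
have growN n : (growthG n <= C * (C * n + C) ^ k + C)%N.
  by apply: ltnW; rewrite -(ltr_nat R) natrD natrM natrX; exact: growC.
pose e := (2 ^ k)%N; pose m := (3 * (8 ^ k * 2))%N.
pose K := (64 ^ e * (C * (C * m + C) ^ k + C))%N.
have bound n : (0 < n)%N -> (n.+1 ^ k.+1 <= K * n.+1 ^ k)%N.
  move=> n_gt0; apply: (@leq_trans (n.+1 ^ e)).
    by rewrite leq_exp2l // ; exact: ltn_expl.
  apply: (@leq_trans (size (evals (2 * n)) ^ e)).
    by rewrite leq_exp2r ?expn_gt0 // ltn_size_evals.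
  apply: leq_trans (_ : size (evals (2 * n)) ^ e * 64 <= _)%N; first by rewrite leq_pmulr.
  apply: leq_trans (size_evals_iter _ _) _; first by rewrite muln_gt0.
  rewrite -mulnA leq_mul2l expn_eq0 /=.
  apply: leq_trans (evals_le_growth _) _; apply: leq_trans (growN _) _.
  rewrite mulnDl -mulnA leq_add ?leq_pmulr ?expn_gt0 // leq_mul2l.
  rewrite -expnMn; case: (posnP k) => [->|k_gt0]; first by rewrite orbT.
  by rewrite leq_exp2r //; apply/orP; right; rewrite /m; nia.
(* At n = K + 1 the bound reads K + 2 <= K. *)
have /= := bound K.+1 isT; rewrite expnS leq_mul2r expn_eq0 /=.
by lia.
Qed.
End Lower.

(** * Minimal words *)

(** Membership in the group, in terms of alternating words. *)
Definition represented (g : aut) : Prop := exists w, aeval w = g.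
Definition rep (g : aut) : seq bcd := xget [::] [set r | aeval r = g /\
  forall w, aeval w = g -> aweight r <= aweight w].
Definition len (g : aut) : nat := aweight (rep g).

Lemma rep_aeval w : aeval (rep (aeval w)) = aeval w /\ len (aeval w) <= aweight w.
Proof.
rewrite /len /rep; set S := (X in xget _ X).
suff : S (xget [::] S) by move=> [-> min]; split=> //; exact: min.
pose P n := `[< exists2 r, aeval r = aeval w & aweight r = n >].
have exP : exists n, P n by exists (aweight w); apply/asboolP; exists w.
case: (ex_minnP exP) => _ /asboolP[r rw <-] min.
apply: (xgetPex [::]); exists r; split=> // u uw.
by apply: min; apply/asboolP; exists u.
Qed.

Lemma len_eval w : len (eval w) <= weight w + 6.
Proof.
rewrite -aeval_alternate; have [_ le] := rep_aeval (alternate w).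
exact: leq_trans le (aweight_alternate w).
Qed.

Definition section_at (g : aut) (p : bool) : aut := eval (section p (alt (rep g))).

(** The term 12 pays for making the words of both sections alternating. *)
Lemma len_section_at g :
  len (section_at g false) + len (section_at g true) + slack (rep g)
    <= len g + 12.
Proof.
have := weight_sections (rep g); rewrite -/(len g).
have := len_eval (section false (alt (rep g))).
by have := len_eval (section true (alt (rep g))); rewrite /section_at; lia.
Qed.

Lemma section_at_inj g h : represented g -> represented h ->
  flips (alt (rep g)) = flips (alt (rep h)) ->
  section_at g false = section_at h false ->
  section_at g true = section_at h true -> g = h.
Proof.
move=> [u <-] [v <-] fe e0 e1.
rewrite -(rep_aeval u).1 -(rep_aeval v).1; apply: eval_section_inj fe _.
by case.
Qed.

(** * Subexponential growth *)

Section Upper.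
Context (R : realType).
Import Order.TTheory GRing.Theory Num.Theory.
Local Open Scope ring_scope.

Lemma ler_sum_subset (T : eqType) (s t : seq T) (F : T -> R) :
  uniq s -> {subset s <= t} -> (forall i, 0 <= F i) ->
  \sum_(i <- s) F i <= \sum_(i <- t) F i.
Proof.
move=> + + F0; elim: s t => [|x s IH] t; first by rewrite big_nil sumr_ge0.
move=> /= /andP[xs us] st; have xt : x \in t by rewrite st ?mem_head.
rewrite (perm_big _ (perm_to_rem xt)) !big_cons lerD2l; apply: IH => // y ys.
apply: rem_mem; last by rewrite st // inE ys orbT.
by apply: contraNneq xs => <-.
Qed.

(** The sum over all words of length at most n is the partial sum of a geometric
series of ratio the sum of [f]. *)
Lemma sum_prod_words (T : finType) (f : T -> R) (W : seq (seq T)) :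
  (forall x, 0 <= f x) -> \sum_x f x < 1 -> uniq W ->
  \sum_(w <- W) \prod_(x <- w) f x <= (1 - \sum_x f x)^-1.
Proof.
move=> f0; set q := \sum_x f x => q1 uW.
have q0 : 0 <= q by exact: sumr_ge0.
pose n := (\max_(w <- W) size w)%N.
have Wn : {subset W <= words T n}.
  by move=> w wW; rewrite mem_words; exact: leq_bigmax_seq.
apply: le_trans (ler_sum_subset uW Wn _) _ => [w|]; first exact: prodr_ge0.
rewrite -[leRHS]mul1r ler_pdivlMr ?subr_gt0 //.
elim: n {Wn} => [|n IH] /=.
  by rewrite big_seq1 big_nil; lra.
rewrite big_cons big_nil big_allpairs_dep.
under eq_bigr => x _.
  under eq_bigr => w _ do rewrite big_cons.
  rewrite -mulr_sumr; over.
rewrite -mulr_suml big_enum -/q; nra.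
Qed.

(** Convergence of the sum of exp(-x len g) over the group, as boundedness of its
finite partial sums. *)
Definition summable_at (x : R) : Prop := exists M : R, forall s : seq aut,
  uniq s -> (forall g, g \in s -> represented g) ->
  \sum_(g <- s) expR (- (x * (len g)%:R)) <= M.

(** The minimal words of distinct elements are distinct, so the sum is at most the one
over all alternating words, a geometric series.  In its ratio the letter t
contributes at most exp(-alpha) < 1, and each of the seven other letters at
most exp(-zeta), which can be made small. *)
Lemma sum_slack (alpha : R) : 0 < alpha -> exists zeta M : R, 0 < zeta /\
  forall s : seq aut, uniq s -> (forall g, g \in s -> represented g) ->
  \sum_(g <- s) expR (- (alpha * (len g)%:R + zeta * (slack (rep g))%:R)) <= M.
Proof.
move=> a0; pose d : R := 1 - expR (- alpha).
have d0 : 0 < d by rewrite subr_gt0 expR_lt1 oppr_lt0.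
pose zeta := 8 / d.
have z0 : 0 < zeta by rewrite divr_gt0.
have zd : 8 * expR (- zeta) < d.
  rewrite expRN ltr_pdivrMr ?expR_gt0 // mulrC -ltr_pdivrMr //.
  by apply: lt_le_trans (expR_ge1Dx _); rewrite -/zeta; lra.
pose f (x : bcd) := expR (- (alpha * (bcd_weight x + 3)%:R + zeta * (x != bcd_t)%:R)).
have f1 : \sum_x f x < 1.
  rewrite (bigD1 bcd_t) //=.
  have ft : f bcd_t <= expR (- alpha).
    rewrite /f eqxx mulr0 addr0 ler_expR lerN2 ler_peMr //; first exact: ltW.
    by rewrite ler1n.
  have fx : \sum_(x | x != bcd_t) f x <= 8 * expR (- zeta).
    apply: le_trans (_ : \sum_(x | x != bcd_t) expR (- zeta) <= _).
      apply: ler_sum => x xt; rewrite /f xt mulr1 ler_expR lerN2 lerDr.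
      by rewrite mulr_ge0 ?ler0n // ltW.
    rewrite sumr_const -[leLHS]mulr_natl ler_pM2r ?expR_gt0 // ler_nat.
    by apply: leq_trans (max_card _) _; rewrite !card_prod card_bool.
  by move: zd; rewrite /d; lra.
exists zeta, (1 - \sum_x f x)^-1; split=> // s us sG.
have fE w : expR (- (alpha * (aweight w)%:R + zeta * (slack w)%:R)) = \prod_(x <- w) f x.
  elim: w => [|x w IH].
    by rewrite /aweight !big_nil /= !mulr0 addr0 oppr0 expR0.
  rewrite big_cons -IH -expRD aweight_cons /= !natrD; congr expR; ring.
rewrite (eq_bigr (fun g => \prod_(x <- rep g) f x)) => [|g _]; last exact: fE.
rewrite -(big_map rep xpredT (fun w => \prod_(x <- w) f x)).
apply: sum_prod_words => //; first by move=> x; exact: expR_ge0.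
rewrite map_inj_in_uniq // => g h /sG[u <-] /sG[v <-] e.
by rewrite -(rep_aeval u).1 -(rep_aeval v).1 e.
Qed.

(** By [len_section_at] each summand is at most exp(12x) times the product of the
summands exp(-x len) of the two sections, and g is determined by these sections
and one bit: summing over all pairs gives 2 exp(12x) M^2. *)
Lemma sum_section_at x : 0 < x -> summable_at x -> exists M : R,
  forall s : seq aut, uniq s -> (forall g, g \in s -> represented g) ->
  \sum_(g <- s) expR (- (x * ((len g)%:R - (slack (rep g))%:R))) <= M.
Proof.
move=> x0 [M sumM]; exists (2 * (expR (x * 12) * (M * M))) => s us sG.
pose h p := undup [seq section_at g p | g <- s].
have hM p : \sum_(g <- h p) expR (- (x * (len g)%:R)) <= M.
  apply: sumM; first exact: undup_uniq.
  move=> g; rewrite mem_undup => /mapP[g' _ ->].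
  by eexists; exact: aeval_alternate.
pose F (t : bool * (aut * aut)) : R :=
  expR (x * 12) * (expR (- (x * (len t.2.1)%:R)) * expR (- (x * (len t.2.2)%:R))).
pose split_ g := (flips (alt (rep g)), (section_at g false, section_at g true)).
apply: (@le_trans _ _ (\sum_(g <- s) F (split_ g))).
  apply: ler_sum => g _; rewrite /F -!expRD ler_expR /=.
  have := len_section_at g; rewrite -(ler_nat R) !natrD => le.
  by rewrite -!mulrN -!mulrDr ler_pM2l //; lra.
rewrite -(big_map split_ xpredT F).
apply: (@le_trans _ _ (\sum_(t <- [seq (b, p) | b <- enum {: bool},
    p <- [seq (g0, g1) | g0 <- h false, g1 <- h true]]) F t)).
  apply: ler_sum_subset.
  - rewrite map_inj_in_uniq // => g g' /sG gG /sG gG' [].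
    exact: section_at_inj.
  - move=> _ /mapP[g gs ->]; apply/allpairsP; exists (split_ g).
    split=> //; first by rewrite mem_enum.
    apply/allpairsP; exists (split_ g).2.
    by split=> //=; rewrite mem_undup; apply/mapP; exists g.
  - by move=> t; rewrite !mulr_ge0 ?expR_ge0.
rewrite big_allpairs big_enum /F /= sumr_const card_bool -[leLHS]mulr_natl ler_pM2l //.
rewrite big_allpairs /=.
under eq_bigr => g _.
  under eq_bigr => g' _ do rewrite mulrA.
  rewrite -mulr_sumr -mulrA; over.
rewrite -mulr_sumr -mulr_suml ler_pM2l ?expR_gt0 //.
by apply: ler_pM => //; apply: sumr_ge0 => ? _; exact: expR_ge0.
Qed.

Lemma summable_le x y : x <= y -> summable_at x -> summable_at y.
Proof.
move=> xy [M sumM]; exists M => s us sG; apply: le_trans (sumM _ us sG).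
by apply: ler_sum => g _; rewrite ler_expR lerN2 ler_wpM2r.
Qed.

(** The growth exponent is zero.  If the infimum xi of the exponents of convergence
were positive, then for x in [xi, xi/(1 - eps)) the sum would converge at
z = x(1 - eps) < xi as well, because each summand at z is bounded by a summand
of [sum_section_at] or of [sum_slack]. *)
Lemma summable_pos y : 0 < y -> summable_at y.
Proof.
pose S : set R := [set x | 0 < x /\ summable_at x]%classic.
(* As slack <= len, the sum of sum_slack dominates the one at 1 + zeta. *)
have S0 : (S !=set0)%classic.
  have [zeta [M [z0 sumM]]] := sum_slack (@ltr01 R).
  exists (1 + zeta); split; first by lra.
  exists M => s us sG; apply: le_trans (sumM _ us sG).
  apply: ler_sum => g _; rewrite ler_expR lerN2 mulrDl lerD2l ler_pM2l // ler_nat.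
  rewrite /len; elim: (rep g) => [//|l w IH].
  by rewrite aweight_cons /=; case: (_ == _) => /=; lia.
have Slb : has_lbound S by exists 0 => x [/ltW].
have Sinf : has_inf S by split.
suff inf0 : inf S <= 0.
  move=> y0; have [x [x0 sx] xy] := inf_adherent y0 Sinf.
  by apply: summable_le sx; lra.
rewrite leNgt; apply/negP => xi0; set xi := inf S in xi0.
have [|zeta [M1 [z0 sum1]]] := @sum_slack (xi / 4); first by lra.
pose eps := Num.min (1 / 2) (xi / (4 * zeta)).
have [e0 e1 e2] : [/\ 0 < eps, eps <= 1 / 2 & eps * zeta <= xi / 4].
  split; first by rewrite lt_min; apply/andP; split; [lra | rewrite divr_gt0 // mulr_gt0].
    by rewrite ge_min lexx.
  rewrite -ler_pdivlMr // ge_min; apply/orP; right.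
  by rewrite invfM mulrA.
have [x Sx xlt] : exists2 x, S x & x < xi / (1 - eps).
  have d0 : 0 < xi / (1 - eps) - xi.
    by rewrite subr_gt0 ltr_pdivlMr; nra.
  have [x Sx xlt] := inf_adherent d0 Sinf; exists x => //.
  by move: xlt; rewrite -/xi; lra.
have xix : xi <= x by exact: ge_inf.
case: (Sx) => x0 sx; have [M2 sum2] := sum_section_at x0 sx.
pose z := x * (1 - eps).
have zxi : z < xi by rewrite /z -ltr_pdivlMr //; lra.
have z2 : xi / 2 <= z by rewrite /z; nra.
suff Sz : S z by move: (ge_inf Slb Sz); rewrite -/xi; lra.
split; first by lra.
exists (M2 + M1) => s us sG.
apply: le_trans (lerD (sum2 _ us sG) (sum1 _ us sG)).
rewrite -big_split /=; apply: ler_sum => g _.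
set L : R := (len g)%:R; set N : R := (slack (rep g))%:R.
have L0 : 0 <= L by exact: ler0n.
have N0 : 0 <= N by exact: ler0n.
(* Many letters other than t: the sections are shorter by a definite factor.
   Few of them: the word is one of a small family. *)
have [N_big|N_small] := leP (eps * L) N.
  apply: le_trans (_ : expR (- (x * (L - N))) <= _); last by rewrite lerDl expR_ge0.
  by rewrite ler_expR lerN2 /z; nra.
apply: le_trans (_ : expR (- (xi / 4 * L + zeta * N)) <= _); last by rewrite lerDr expR_ge0.
rewrite ler_expR lerN2.
have : zeta * N <= eps * zeta * L by nra.
have : eps * zeta * L <= xi / 4 * L by nra.
have : xi / 2 * L <= z * L by nra.
lra.
Qed.

(** Since each g in the ball of radius n has len g <= 5n + 6, convergence at x gives
gamma(n) <= M exp(x(5n + 6)), and x is chosen with 5Cx <= 1/2: this turns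
exp(n) < C gamma(Cn + C) + C into a bound on exp(n/2). *)
Lemma not_exponential : ~ exponential_growth R Gtilde Gtilde_gens.
Proof.
move=> [C expC].
have [x [x0 xC]] : exists x : R, 0 < x /\ x * (5 * C%:R) <= 1 / 2.
  exists (1 / (10 * C%:R + 1)); have C0 := ler0n R C.
  split; first by rewrite divr_gt0 //; lra.
  by rewrite mulrAC ler_pdivrMr; lra.
have [M sumM] := summable_pos x0.
have evals_le n : (size (evals n))%:R <= M * expR (x * (5 * n + 6)%:R).
  rewrite -ler_pdivrMr ?expR_gt0 // -expRN.
  have /sumM : uniq (evals n) by exact: undup_uniq.
  move=> /(_ _) le; apply: le_trans (le _); last first.
    by move=> g /evalsP[w _ <-]; eexists; exact: aeval_alternate.
  rewrite -sum1_size natr_sum mulr_suml big_seq [leRHS]big_seq.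
  apply: ler_sum => g /evalsP[w wn <-].
  rewrite mul1r ler_expR lerN2 ler_pM2l // ler_nat.
  apply: leq_trans (len_eval _) _; rewrite leq_add2r.
  apply: leq_trans (_ : 5 * size w <= _)%N; last by rewrite leq_mul2l.
  elim: w {wn} => [|l w IH]; first by rewrite /weight big_nil.
  rewrite weight_cons mulnS leq_add //.
  by case: l => [[[[] []] []]|].
pose K := C%:R * (`|M| * expR (x * (5 * C + 6)%:R)) + C%:R.
have K0 : 0 <= K by rewrite /K addr_ge0 ?mulr_ge0 ?expR_ge0 ?ler0n.
have bound n : expR (n%:R / 2) <= K :> R.
  have C0 := ler0n R C.
  have h0 : 0 < expR (n%:R / 2) :> R by exact: expR_gt0.
  have h1 : 1 <= expR (n%:R / 2) :> R.
    by apply: le_trans (expR_ge1Dx _); rewrite lerDl divr_ge0.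
  have grow : (growth Gtilde Gtilde_gens (C * n + C))%:R <=
      `|M| * expR (x * (5 * C + 6)%:R) * expR (n%:R / 2) :> R.
    have le1 := growth_le_evals (C * n + C); rewrite -(ler_nat R) in le1.
    apply: (le_trans le1); apply: (le_trans (evals_le _)).
    apply: (@le_trans _ _ (`|M| * expR (x * (5 * (C * n + C) + 6)%:R))).
      by rewrite ler_wpM2r ?expR_ge0 // ler_norm.
    rewrite -mulrA ler_wpM2l // -expRD ler_expR !(natrD, natrM).
    have n0 := ler0n R n; nra.
  rewrite -(ler_pM2r h0) -expRD -splitr.
  apply: le_trans (ltW (expC n)) _.
  have := ler_wpM2l C0 grow; rewrite /K; nra.
have [n Kn] : exists n : nat, 2 * K < n%:R.
  by exists (Num.Def.archi_bound (2 * K)); apply: archi_boundP; lra.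
have := bound n; apply/negP; rewrite -ltNge.
by apply: lt_le_trans (expR_ge1Dx _); lra.
Qed.

End Upper.

Theorem theorem5p13 (R : realType) : intermediate_growth R Gtilde Gtilde_gens.
Proof. by split; [exact: not_polynomial | exact: not_exponential]. Qed.
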